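(* Let $X$ be a real Banach space, $K\subset X$ a nonempty closed convex set, and $f:K\times K\to\mathbb{R}$ a bifunction with $f\in\overline{\mathcal{C}}(K)$. Then $\operatorname{EP}(f_i,K)=\operatorname{EP}(f,K)$ for every $i\in\{c,q,s,\overline{c},\overline{q}\}$.
   Context: For $h:X\to[-\infty,+\infty]$ let $\operatorname{epi}(h)=\{(x,\lambda)\in X\times\mathbb{R}: h(x)\le\lambda\}$ and $S_\lambda(h)=\{x\in X: h(x)\le\lambda\}$. The regularizations of $h$ are (with $\inf\emptyset=+\infty$; closures in the norm topology; $\mathrm{co}$, $\overline{\mathrm{co}}$ denote convex hull and closed convex hull): $h_s(x)=\inf\{\lambda\in\mathbb{R}:(x,\lambda)\in\overline{\operatorname{epi}(h)}\}$, $h_c(x)=\inf\{\lambda\in\mathbb{R}:(x,\lambda)\in\mathrm{co}(\operatorname{epi}(h))\}$, $h_{\overline{c}}(x)=\inf\{\lambda\in\mathbb{R}:(x,\lambda)\in\overline{\mathrm{co}}(\operatorname{epi}(h))\}$, $h_q(x)=\inf\{\lambda\in\mathbb{R}:x\in\mathrm{co}(S_\lambda(h))\}$, $h_{\overline{q}}(x)=\inf\{\lambda\in\mathbb{R}:x\in\overline{\mathrm{co}}(S_\lambda(h))\}$. For a bifunction $f:K\times K\to\mathbb{R}$ and $x\in K$, the function $f(x,\cdot)$ is extended to $X$ by $+\infty$ outside $K$, and $f_i(x,\cdot)=(f(x,\cdot))_i$ for $i\in\{s,c,\overline{c},q,\overline{q}\}$; $f_i$ is regarded as a bifunction on $K\times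 K$. $\overline{\mathcal{C}}(K)$ is the family of bifunctions $f:K\times K\to\mathbb{R}$ such that $f_{\overline{c}}(x,y)\in\mathbb{R}$ for all $x,y\in K$. For a bifunction $g$ on $K\times K$, $\operatorname{EP}(g,K)=\{x\in K: g(x,y)\ge0\text{ for all }y\in K\}$. *)

(* Defs.v *)
From HB Require Import structures.
From mathcomp Require Import all_boot all_order all_algebra.
From mathcomp Require Import all_classical all_reals all_analysis.

Set Implicit Arguments.
Unset Strict Implicit.
Unset Printing Implicit Defensive.

Import Order.TTheory GRing.Theory Num.Theory.
Import numFieldNormedType.Exports.

Local Open Scope classical_set_scope.
Local Open Scope ring_scope.
Local Open Scope ereal_scope.

Definition conv_hull (R : realType) (E : normedModType R) (A : set E) : set E :=
  smallest (@convex_set R E) A.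

Definition closed_conv_hull (R : realType) (E : normedModType R) (A : set E) :
    set E :=
  smallest [set C : set E | closed C /\ convex_set C] A.

(* The second factor is R^o, which is R as a normed module over itself, so that
   the product carries the product vector space structure and topology. *)
Definition epi (R : realType) (X : normedModType R) (h : X -> \bar R) :
    set (X * R^o) :=
  [set p | h p.1 <= (p.2)%:E].

Definition sublevel (R : realType) (X : normedModType R) (h : X -> \bar R)
    (lambda : R) : set X :=
  [set x | h x <= lambda%:E].

Definition reg_s (R : realType) (X : normedModType R) (h : X -> \bar R) (x : X) :
    \bar R :=
  ereal_inf [set lambda%:E | lambda in [set l : R | closure (epi h) (x, l)]].

Definition reg_c (R : realType) (X : normedModType R) (h : X -> \bar R) (x : X) :
    \bar R :=
  ereal_inf [set lambda%:E | lambda in [set l : R | conv_hull (epi h) (x, l)]].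

Definition reg_cbar (R : realType) (X : normedModType R) (h : X -> \bar R)
    (x : X) : \bar R :=
  ereal_inf
    [set lambda%:E | lambda in [set l : R | closed_conv_hull (epi h) (x, l)]].

Definition reg_q (R : realType) (X : normedModType R) (h : X -> \bar R) (x : X) :
    \bar R :=
  ereal_inf [set lambda%:E | lambda in [set l : R | conv_hull (sublevel h l) x]].

Definition reg_qbar (R : realType) (X : normedModType R) (h : X -> \bar R)
    (x : X) : \bar R :=
  ereal_inf
    [set lambda%:E | lambda in [set l : R | closed_conv_hull (sublevel h l) x]].

Inductive reg_kind := Reg_s | Reg_c | Reg_cbar | Reg_q | Reg_qbar.

Definition reg (R : realType) (X : normedModType R) (i : reg_kind) :
    (X -> \bar R) -> X -> \bar R :=
  match i with
  | Reg_s => @reg_s R X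
  | Reg_c => @reg_c R X
  | Reg_cbar => @reg_cbar R X
  | Reg_q => @reg_q R X
  | Reg_qbar => @reg_qbar R X
  end.

(* Bifunctions on K * K are encoded as total functions on X * X; the values
   outside K * K are never used. *)
Definition extend (R : realType) (X : normedModType R) (K : set X) (h : X -> R) :
    X -> \bar R :=
  patch (fun=> +oo) K (fun y => (h y)%:E).

Definition bireg (R : realType) (X : normedModType R) (i : reg_kind) (K : set X)
    (f : X -> X -> R) (x y : X) : \bar R :=
  reg i (extend K (f x)) y.

Definition class_Cbar (R : realType) (X : normedModType R) (K : set X) :
    set (X -> X -> R) :=
  [set f | forall x y, K x -> K y -> bireg Reg_cbar K f x y \is a fin_num].

Definition EP (R : realType) (X : normedModType R) (g : X -> X -> \bar R)
    (K : set X) : set X :=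
  [set x | K x /\ forall y, K y -> 0 <= g x y].

(* Main.v *)
Require Import Defs.
From HB Require Import structures.
From mathcomp Require Import all_boot all_order all_algebra.
From mathcomp Require Import all_classical all_reals all_analysis.
Import Order.TTheory GRing.Theory Num.Theory.
Import numFieldNormedType.Exports.

Local Open Scope classical_set_scope.
Local Open Scope ring_scope.

(** Each regularization [reg i h] lies below [h], because every hull contains
    the set it is taken of ([reg_le]).  Conversely, a constant minorant of [h]
    also minorizes [reg i h] ([reg_ge_cst]): if [m <= h] everywhere, then the
    epigraph of [h] lies in the closed half-space of points of height at least
    [m], which is closed and convex and hence contains every hull of the
    epigraph; and the sublevel sets of [h] below [m] are empty, hence so are
    their hulls.

    Take [m = 0].  The extension of [f x] by [+oo] is nonnegative on the whole
    space if and only if [f x] is nonnegative on [K], so the two facts give the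
    two inclusions between the solution sets. *)

Lemma closed_upper_halfspace (R : realType) (X : normedModType R) (m : R) :
  closed [set p : X * R^o | m <= p.2].
Proof.
apply: (@preimage_closed (X * R^o)%type R^o snd [set y | m <= y]).
  by move=> p _; exact: cvg_snd.
exact: closed_ge.
Qed.

Lemma convex_upper_halfspace (R : realType) (X : normedModType R) (m : R) :
  convex_set ([set p : X * R^o | m <= p.2] : set (convex_lmodType _)).
Proof.
move=> x y t; rewrite !inE /= => mx my.
(* [m] is the convex combination of itself with itself. *)
have -> : m = t%:num * m + (1 - t%:num) * m by rewrite -mulrDl subrKC mul1r.
have t1 : 0 <= 1 - t%:num by rewrite subr_ge0.
by apply: lerD; apply: ler_wpM2l.
Qed.

Lemma closed_conv_hull_set0 (R : realType) (X : normedModType R) :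
  closed_conv_hull (set0 : set X) = set0.
Proof.
apply: smallest_id; split; first exact: closed0.
by move=> x y t; rewrite inE.
Qed.

Lemma conv_hull_set0 (R : realType) (X : normedModType R) :
  conv_hull (set0 : set X) = set0.
Proof. by apply: smallest_id => x y t; rewrite inE. Qed.

Lemma sublevel_eq0 (R : realType) (X : normedModType R) (h : X -> \bar R)
    (m l : R) :
  (forall x, (m%:E <= h x)%E) -> l < m -> sublevel h l = set0.
Proof.
move=> mh lm; rewrite -subset0 => x /= hl.
by have := le_trans (mh x) hl; rewrite lee_fin leNgt lm.
Qed.

(** Each regularization is the infimum of the real levels admitted by a closure
    or hull of an epigraph or sublevel set; a level admitted by [h] itself is
    admitted by all of them. *)
Lemma reg_le (R : realType) (X : normedModType R) (i : reg_kind)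
    (h : X -> \bar R) (x : X) (l : R) :
  (h x <= l%:E)%E -> (reg i h x <= l%:E)%E.
Proof.
move=> hl; case: i; apply: ereal_inf_lbound; exists l => //=.
- exact: subset_closure.
- exact: sub_gen_smallest.
- exact: sub_gen_smallest.
- exact: sub_gen_smallest.
- exact: sub_gen_smallest.
Qed.

(** A half-space bounds the epigraph and its hulls from below.  The quasiconvex
    hulls are taken level by level in [X], where no half-space is available;
    there the bound comes from the emptiness of the sublevel sets below [m]. *)
Lemma reg_ge_cst (R : realType) (X : normedModType R) (i : reg_kind)
    (h : X -> \bar R) (m : R) :
  (forall x, (m%:E <= h x)%E) -> forall x, (m%:E <= reg i h x)%E.
Proof.
move=> mh x.
have epi_sub : epi h `<=` [set p : X * R^o | m <= p.2].
  by move=> p /(le_trans (mh p.1)); rewrite lee_fin.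
case: i; apply: le_ereal_inf_tmp => _ /= [l hl <-]; rewrite lee_fin.
- have cl := (closure_id _).1 (closed_upper_halfspace R X m).
  by move/(closureS epi_sub): hl; rewrite -cl.
- exact: (smallest_sub (convex_upper_halfspace R X m) epi_sub hl).
- exact: (smallest_sub (conj (closed_upper_halfspace R X m)
    (convex_upper_halfspace R X m)) epi_sub hl).
- rewrite leNgt; apply/negP => /(sublevel_eq0 _ _ _ _ _ mh) S0.
  by rewrite S0 conv_hull_set0 in hl.
- rewrite leNgt; apply/negP => /(sublevel_eq0 _ _ _ _ _ mh) S0.
  by rewrite S0 closed_conv_hull_set0 in hl.
Qed.

Theorem proposition4p1 (R : realType) (X : completeNormedModType R) (K : set X)
    (f : X -> X -> R) :
  K !=set0 -> closed K -> convex_set K -> class_Cbar K f ->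
  forall i : reg_kind,
    EP (bireg i K f) K = EP (fun x y => (f x y)%:E) K.
Proof.
move=> _ _ _ _ i; apply/seteqP; split=> x [Kx EPx]; split=> // y Ky.
  apply: le_trans (EPx y Ky) _; apply: reg_le.
  by rewrite /extend /patch mem_set.
(* Off [K] the extension is [+oo], so [EPx] makes [0] a minorant on [X]. *)
apply: reg_ge_cst => z; rewrite /extend /patch.
by case: ifPn => [/set_mem/EPx|_]//; rewrite leey.
Qed.
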